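(* Let $n\geq 2$ be even. Among all $n$-vertex conjugated trees, the path $P_n$ has the maximal total-eccentricity index; that is, $\tau(T)\leq \tau(P_n)$ for every $n$-vertex conjugated tree $T$.
   Context: All graphs are finite and simple. For a connected graph $G$, the eccentricity $e_G(v)$ of a vertex $v$ is the largest distance from $v$ to any other vertex of $G$. The total-eccentricity index of $G$ is $\tau(G)=\sum_{u\in V(G)} e_G(u)$. A conjugated graph is a graph containing a perfect matching (so its order is even). $P_n$ denotes the path on $n$ vertices. *)

(* Defs.v *)
From mathcomp Require Import all_boot.
Set Implicit Arguments.
Unset Strict Implicit.
Unset Printing Implicit Defensive.

Record sgraph := SGraph {
  vertex :> finType;
  edge : rel vertex;
  edge_sym : symmetric edge;
  edge_irr : irreflexive edge
}.

Section Graph.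
Variable G : sgraph.

Definition connected : Prop :=
  0 < #|G| /\ forall x y : G, connect (@edge G) x y.

(* [ucycle] is a closed walk without repeated vertices; sizes 1 and 2 are not
   cycles of a simple graph. *)
Definition acyclic : Prop :=
  forall c : seq G, 2 < size c -> ~ ucycle (@edge G) c.

Definition tree : Prop := connected /\ acyclic.

Definition has_walk (x y : G) (k : nat) : bool :=
  [exists p : k.-tuple G, path (@edge G) x p && (last x p == y)].

(* The least length of a walk from x to y.  A shortest walk has no repeated
   vertex, so its length is below #|G|; for x, y in different components the
   value is the dummy #|G|. *)
Definition dist (x y : G) : nat := find (has_walk x y) (iota 0 #|G|).

Definition ecc (v : G) : nat := \max_(u : G | u != v) dist v u.

Definition total_ecc : nat := \sum_(u : G) ecc u.

Definition edges : {set {set G}} :=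
  [set [set p.1; p.2] | p : G * G & edge p.1 p.2].

Definition perfect_matching (M : {set {set G}}) : Prop :=
  [/\ M \subset edges, trivIset M & cover M = [set: G]].

Definition conjugated : Prop := exists M : {set {set G}}, perfect_matching M.

End Graph.

Definition path_edge (n : nat) : rel 'I_n :=
  fun i j => (i.+1 == j :> nat) || (j.+1 == i :> nat).

Lemma path_edge_sym n : symmetric (@path_edge n).
Proof. by move=> i j; rewrite /path_edge orbC. Qed.

Lemma path_edge_irr n : irreflexive (@path_edge n).
Proof. by move=> i; rewrite /path_edge orbb; apply/negbTE; rewrite neq_ltn ltnSn orbT. Qed.

Definition path_graph (n : nat) : sgraph :=
  SGraph (@path_edge_sym n) (@path_edge_irr n).

Definition conjugated_tree (n : nat) (G : sgraph) : Prop :=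
  [/\ #|G| = n, tree G & conjugated G].

(* Main.v *)
Require Import Defs.
From mathcomp Require Import all_boot zify.

Set Implicit Arguments.
Unset Strict Implicit.
Unset Printing Implicit Defensive.

(** The inequality comes from one cut-vertex argument.  Let [a], [b] be at
maximal distance [D] in a connected graph on [n] vertices, and sort the
vertices into layers by their distance to [a]; layers [0, ..., D] are all
nonempty.  If layer [i] is a single vertex [c], every walk between lower and
higher layers passes through [c] ([crossing_layer]), so a vertex at distance
more than [maxn i (D - i)] from [c] would be at distance more than [D] from
[a] or from [b]; hence [ecc c <= maxn i (D - i)] ([ecc_cut_vertex]), exactly
the eccentricity of the vertex [i] of a path of length [D].  In a larger
layer only the bound [D] is available; it exceeds [maxn i (D - i)] by at most
[D./2], and this is charged to the extra vertices of the layer, so that each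
of the [n - D - 1] vertices in excess of one per layer costs at most
[D + D./2] ([layer_ecc_leq]).

On the path side, lengthening a path by one vertex at length [m >= D] raises
its total eccentricity by at least [m + m./2 >= D + D./2]: the new end
contributes [m.+1], and about half of the old vertices get one further away
from the end that moved ([path_ecc_sumS]).  Starting from the path of length
[D] and adding the [n - D - 1] excess vertices one at a time therefore
dominates the total eccentricity of the graph. *)

(** * Distance as a metric *)

Section Distance.
Variable G : sgraph.
Implicit Types x y z u v a b c : G.

Lemma has_walkP x y k :
  reflect (exists p, [/\ path (@edge G) x p, last x p = y & size p = k])
          (has_walk x y k).
Proof.
apply: (iffP existsP) => [[p /andP[xp /eqP <-]]|[p [xp <- <-]]].
  by exists p; rewrite size_tuple.
by exists (in_tuple p); rewrite xp eqxx.
Qed.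

Lemma dist_leq x y k : has_walk x y k -> dist x y <= k.
Proof.
move=> w; rewrite /dist; have [kn|nk] := ltnP k #|G|; last first.
  by apply: leq_trans nk; rewrite -[leqRHS](size_iota 0) find_size.
rewrite leqNgt; apply/negP => /(before_find 0).
by rewrite nth_iota // add0n w.
Qed.

Lemma dist_leq_path x p : path (@edge G) x p -> dist x (last x p) <= size p.
Proof. by move=> xp; apply/dist_leq/has_walkP; exists p. Qed.

Lemma dist_xx x : dist x x = 0.
Proof. by apply/eqP; rewrite -leqn0; exact: (@dist_leq_path x [::]). Qed.

Lemma dist_edge x y : edge x y -> dist x y <= 1.
Proof. by move=> xy; apply: (@dist_leq_path x [:: y]); rewrite /= xy. Qed.

Lemma leq_dist_ecc x y : dist x y <= ecc x.
Proof.
have [->|yx] := eqVneq y x; first by rewrite dist_xx.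
exact: (@leq_bigmax_cond _ (fun u => u != x) (dist x)).
Qed.

Lemma ecc_leqP x m : reflect (forall u, dist x u <= m) (ecc x <= m).
Proof.
apply: (iffP idP) => [le_m u|le_m]; first exact: leq_trans (leq_dist_ecc x u) _.
by apply/bigmax_leqP => u _.
Qed.

Hypothesis connG : connected G.

(** Vertices in different components get the dummy value [#|G|]; strictness is
what tells that [dist] is the length of an actual walk. *)
Lemma dist_lt_card x y : dist x y < #|G|.
Proof.
have /connectP[p0 xp0 ->] := connG.2 x y.
case/shortenP: xp0 => p xp /card_uniqP up _.
by apply: leq_ltn_trans (dist_leq_path xp) _; rewrite -[_.+1]up max_card.
Qed.

Lemma shortest_walk x y :
  exists p, [/\ path (@edge G) x p, last x p = y & size p = dist x y].
Proof.
apply/has_walkP; have lt_d := dist_lt_card x y.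
have hw : has (has_walk x y) (iota 0 #|G|) by rewrite has_find size_iota.
by have := nth_find 0 hw; rewrite nth_iota.
Qed.

Lemma dist_triangle x y z : dist x z <= dist x y + dist y z.
Proof.
have [p [xp lp <-]] := shortest_walk x y; have [q [yq <- <-]] := shortest_walk y z.
by rewrite -lp -last_cat -size_cat dist_leq_path // cat_path xp lp.
Qed.

Lemma dist_sym_leq x y : dist y x <= dist x y.
Proof.
have [p [xp lp <-]] := shortest_walk x y.
elim: p x xp lp => [|z p IHp] x /= => [_ <-|/andP[xz zp] lp].
  by rewrite dist_xx.
apply: leq_trans (dist_triangle y z x) _; rewrite -addn1 leq_add ?IHp //.
by apply: dist_edge; rewrite edge_sym.
Qed.

Lemma dist_sym x y : dist x y = dist y x.
Proof. by apply/eqP; rewrite eqn_leq !dist_sym_leq. Qed.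

(** Discrete intermediate value theorem: the distance to [a] changes by at most
one along an edge, so a shortest walk from [x] to [y] meets every
intermediate layer, at a vertex [z] that splits it into two shortest walks. *)
Lemma crossing_layer a x y i : dist a x <= i <= dist a y ->
  exists2 z, dist a z = i & dist x z + dist z y <= dist x y.
Proof.
have [p [xp lp <-]] := shortest_walk x y.
elim: p x xp lp => [|x' p IHp] x /= => [_ <-|/andP[xx' xp] lp] /andP[ax ay].
  by exists x; rewrite ?dist_xx //; apply/eqP; rewrite eqn_leq ax ay.
have [axi|] := eqVneq (dist a x) i.
  exists x => //; rewrite dist_xx -lp.
  by apply: (@dist_leq_path x (x' :: p)); rewrite /= xx'.
have xx1 := dist_edge xx'.
move=> ne_i; have ax' : dist a x' <= i.
  by have := dist_triangle a x x'; lia.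
case: (IHp x' xp lp) => [|z az zy]; first by rewrite ax' ay.
by exists z => //; have := dist_triangle x x' z; lia.
Qed.

End Distance.

(** * Growth of the total eccentricity of paths *)

(** The total eccentricity of the path of length [m], that is, on [m.+1]
vertices. *)
Definition path_ecc_sum m := \sum_(i < m.+1) maxn i (m - i).

Lemma sum_ltn_ord n k : k <= n -> \sum_(i < n) (i < k) = k.
Proof.
elim: n k => [|n IHn] k; first by rewrite leqn0 big_ord0 => /eqP ->.
rewrite leq_eqVlt => /predU1P[->|kn].
  rewrite -[RHS]muln1 -[in RHS](card_ord n.+1) -sum_nat_const.
  by apply: eq_bigr => i _; rewrite ltn_ord.
by rewrite big_ord_recr /= IHn // ltnNge -ltnS kn addn0.
Qed.

(** The last summand is [m.+1], and each [i < m./2] lies closer to the fixed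
end [0], so [m - i] is the maximum there and grows by one. *)
Lemma path_ecc_sumS m : path_ecc_sum m + (m + m./2) <= path_ecc_sum m.+1.
Proof.
rewrite [leqRHS]big_ord_recr /= subnn maxn0.
have <- : \sum_(i < m.+1) (i < m./2) = m./2 by apply: sum_ltn_ord; lia.
rewrite addnCA -big_split /= addnC leq_add // leq_sum // => i _.
by have := ltn_ord i; case: (ltnP i m./2); lia.
Qed.

Lemma path_ecc_sum_add D e :
  path_ecc_sum D + e * (D + D./2) <= path_ecc_sum (D + e).
Proof.
elim: e => [|e IHe]; first by rewrite mul0n !addn0.
rewrite addnS; apply: leq_trans (path_ecc_sumS _).
by rewrite mulSn addnCA addnC leq_add //; lia.
Qed.

(** * Layers between the ends of a diameter *)

Section Diametral.
Variables (G : sgraph) (a b : G).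
Hypothesis connG : connected G.
Hypothesis diam : forall x y : G, dist x y <= dist a b.

(** A vertex [u] below the layer of [c] reaches [b] through [c], and one above
is reached from [a] through [c]; both of these detours have length at most
[dist a b], which bounds [dist c u]. *)
Lemma ecc_cut_vertex c : (forall z : G, dist a z = dist a c -> z = c) ->
  ecc c <= maxn (dist a c) (dist a b - dist a c).
Proof.
move=> c1; apply/ecc_leqP => u; rewrite leq_max.
have [uc|cu] := ltnP (dist a u) (dist a c).
  have [|z /c1 -> ucb] := @crossing_layer _ connG a u b (dist a c).
    by rewrite ltnW ?diam.
  have := dist_triangle connG a c b; have := diam u b.
  by rewrite [dist c u]dist_sym //; lia.
have [|z /c1 -> acu] := @crossing_layer _ connG a a u (dist a c).
  by rewrite dist_xx.
by have := diam a u; lia.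
Qed.

(** A layer of [m] vertices is charged [m - 1] times the cost of an excess
vertex; the remaining copy of that cost stands on the left, which keeps the
bound additive over layers. *)
Lemma layer_ecc_leq i : i <= dist a b ->
  \sum_(u | dist a u == i) ecc u + (dist a b + (dist a b)./2)
    <= maxn i (dist a b - i)
       + #|[pred u | dist a u == i]| * (dist a b + (dist a b)./2).
Proof.
move=> iD; have ecc_D (u : G) : ecc u <= dist a b by apply/ecc_leqP => w.
have [|c ci _] := @crossing_layer _ connG a a b i; first by rewrite dist_xx.
set m := #|_|; have m_gt0 : 0 < m by apply/card_gt0P; exists c; apply/eqP.
have [m_le1|m_gt1] := leqP m 1.
  have c1 (z : G) : dist a z = i -> z = c.
    by move=> zi; apply: (card_le1_eqP m_le1); apply/eqP.
  rewrite (big_pred1 c) => [|u /=]; last by apply/eqP/eqP => [/c1|->].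
  have -> : m = 1 by lia.
  by rewrite mul1n leq_add2r -{1 2}ci; apply: ecc_cut_vertex => z;
    rewrite ci => /c1.
(* With [D = dist a b], [maxn i (D - i) >= D - D./2], so two copies of
   [D./2] suffice: one lifts the maximum to [D], the other is on the left. *)
have: \sum_(u | dist a u == i) ecc u <= m * dist a b.
  by rewrite -sum_nat_const leq_sum.
have: 2 * (dist a b)./2 <= m * (dist a b)./2 by rewrite leq_mul2r m_gt1 orbT.
by rewrite mulnDr; lia.
Qed.

Lemma total_ecc_diam_leq : total_ecc G <= path_ecc_sum #|G|.-1.
Proof.
set D := dist a b; set K := D + D./2.
have lt_D : D < #|G| by exact: dist_lt_card.
have ltD (u : G) : dist a u < D.+1 by rewrite ltnS diam.
have sum_layers (F : G -> nat) :
  \sum_u F u = \sum_(i < D.+1) \sum_(u | dist a u == i) F u.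
  by rewrite (partition_big (fun u => Ordinal (ltD u)) predT).
have cardG : #|G| = \sum_(i < D.+1) #|[pred u | dist a u == i]|.
  by rewrite -sum1_card sum_layers; apply: eq_bigr => i _; rewrite sum1_card.
have: total_ecc G + D.+1 * K <= path_ecc_sum D + #|G| * K.
  have -> : D.+1 * K = \sum_(i < D.+1) K by rewrite sum_nat_const card_ord.
  rewrite /total_ecc sum_layers cardG big_distrl -!big_split /=.
  by apply: leq_sum => i _; rewrite layer_ecc_leq // -ltnS.
have eG : #|G| = D.+1 + (#|G|.-1 - D) by lia.
rewrite [in leqRHS]eG mulnDl addnCA addnC leq_add2l => /leq_trans; apply.
by rewrite -[in leqRHS](subnKC (n := #|G|.-1) (m := D)) ?path_ecc_sum_add; lia.
Qed.

End Diametral.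

Lemma total_ecc_leq (G : sgraph) :
  connected G -> total_ecc G <= path_ecc_sum #|G|.-1.
Proof.
move=> connG; have /card_gt0P[x0 _] := connG.1.
pose p := [arg max_(p > (x0, x0)) dist p.1 p.2].
apply: (@total_ecc_diam_leq _ p.1 p.2) => // x y.
by rewrite /p; case: arg_maxnP => //= q _ /(_ (x, y)); apply.
Qed.

(** * The path graph *)

Lemma path_graph_path_leq n (x : path_graph n) p :
  path (@edge (path_graph n)) x p ->
  last x p <= x + size p /\ x <= last x p + size p.
Proof.
elim: p x => [|y p IHp] x /=; first by rewrite addn0.
by case/andP=> /orP[] /eqP xy /IHp []; rewrite /= in xy *; lia.
Qed.

Lemma path_graph_connected m : connected (path_graph m.+1).
Proof.
split=> [|x y]; first by rewrite card_ord.
have c0 (z : path_graph m.+1) : connect (@edge (path_graph m.+1)) ord0 z.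
  case: z => k; elim: k => [|k IHk] lt_k.
    by rewrite (_ : Ordinal lt_k = ord0) //; apply: val_inj.
  apply: connect_trans (IHk (ltnW lt_k)) (connect1 _).
  by rewrite /= /path_edge /= eqxx.
apply: connect_trans (c0 y).
by rewrite (sym_connect_sym (@edge_sym _)) c0.
Qed.

Lemma path_graph_ecc m (i : path_graph m.+1) : maxn i (m - i) <= ecc i.
Proof.
have connP := path_graph_connected m.
rewrite geq_max; apply/andP; split.
  apply: leq_trans (leq_dist_ecc i ord0).
  have [p [/path_graph_path_leq ip lp <-]] := shortest_walk connP i ord0.
  by move: ip; rewrite lp /=; lia.
apply: leq_trans (leq_dist_ecc i ord_max).
have [p [/path_graph_path_leq ip lp <-]] := shortest_walk connP i ord_max.
by move: ip; rewrite lp /=; lia.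
Qed.

Lemma path_graph_total_ecc m : path_ecc_sum m <= total_ecc (path_graph m.+1).
Proof. by apply: leq_sum => i _; apply: path_graph_ecc. Qed.

(** The largest vertex [m] of a cycle would have two distinct neighbours on it,
both smaller than [m], but [m.-1] is its only smaller neighbour. *)
Lemma path_graph_acyclic n : acyclic (path_graph n).
Proof.
move=> c szc cyc; case: c szc cyc => // x0 c0; set c := x0 :: c0 => szc cyc.
have x0c : x0 \in c by rewrite mem_head.
case: (@arg_maxnP _ x0 (mem c) (fun i : 'I_n => val i) x0c) => m mc m_max.
have [k c' rot_c] := rot_to mc.
have cyc' : ucycle (@edge (path_graph n)) (m :: c') by rewrite -rot_c rot_ucycle.
have le_m z : z \in m :: c' -> z <= m by rewrite -rot_c mem_rot => /m_max.
have : 2 < size (m :: c') by rewrite -rot_c size_rot.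
case: c' cyc' le_m {rot_c} => // x c'.
elim/last_ind: c' => // c' y _ cyc' le_m _.
case/andP: cyc'; rewrite /= rcons_path last_rcons => /and3P[mx _ ym] /andP[_].
have xm := le_m x; have {}ym' := le_m y.
rewrite mem_rcons inE => /andP[/norP[/eqP xy _] _]; apply: xy; apply: val_inj.
move: mx ym; rewrite /path_edge /=.
have {}xm : x <= m by rewrite xm // !inE eqxx orbT.
have {}ym' : y <= m by rewrite ym' // !inE mem_rcons inE eqxx !orbT.
by move=> /orP[] /eqP ? /orP[] /eqP ?; lia.
Qed.

(** The edges [{2k, 2k+1}], obtained as the classes of [i ~ j] iff
[i./2 = j./2]. *)
Lemma path_graph_conjugated n : ~~ odd n -> conjugated (path_graph n).
Proof.
move=> n_even; pose half (i : path_graph n) := i./2.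
have /and3P[/eqP cov triv _] := preim_partitionP half setT.
exists (preim_partition half setT); split=> //.
apply/subsetP => _ /imsetP[i _ ->].
have lt0 : (i./2).*2 < n by have := ltn_ord i; lia.
have lt1 : (i./2).*2.+1 < n by have := ltn_ord i; lia.
apply/imsetP; exists (Ordinal lt0, Ordinal lt1).
  by rewrite inE /= /path_edge /= eqxx.
apply/setP => j; rewrite !inE /half -!val_eqE /=; lia.
Qed.

Theorem theorem4p5 (n : nat) (hn : 2 <= n) (hev : ~~ odd n) :
  conjugated_tree n (path_graph n) /\
  forall T : sgraph, conjugated_tree n T ->
    total_ecc T <= total_ecc (path_graph n).
Proof.
have n_pos : 0 < n by apply: ltnW.
split=> [|T [cardT [connT _] _]].
  split; first by rewrite card_ord.
    split; last exact: path_graph_acyclic.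
    by rewrite -(prednK n_pos); apply: path_graph_connected.
  exact: path_graph_conjugated.
apply: leq_trans (total_ecc_leq connT) _; rewrite cardT.
by rewrite -[in leqRHS](prednK n_pos); apply: path_graph_total_ecc.
Qed.
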